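(* Define $z,y\in\mathbb{R}^n$ by $z_i=\max_{w\in X_2\cap X_4}w_i$ and $y_i=\min_{w\in X_1\cap X_3}w_i$, $i\in\{1,\dots,n\}$. Then $X\ne\varnothing$ if and only if $y\le z$ (componentwise). Moreover, if $X\neq\varnothing$, then for every $i\in\{1,\dots,n\}$, $\max_{w\in X}w_i=z_i$ and $\min_{w\in X}w_i=y_i$.
   Context: Let $n\ge 3$, let $h,M,P_{\max},g,\mu,\gamma>0$, $c\ge 0$, and $\alpha_1,\dots,\alpha_{n-1}\in(-\pi/2,\pi/2)$. Let $\hat w_i>0$ solve $\frac{P_{\max}}{M\sqrt{2\hat w_i}}=g\mu\cos\alpha_i$; standing assumption on $h$: $1-h\gamma-h\frac{P_{\max}}{M(2\hat w_i)^{3/2}}\ge 0$ for all $i\in\{1,\dots,n-1\}$. Put $\beta_i(w)=\min\{\frac{P_{\max}}{M\sqrt{2w}},g\mu\cos\alpha_i\}$, with the convention that $\frac{P_{\max}}{M\sqrt{2w}}=+\infty$ for $w\le 0$ (so $\beta_i(w)=g\mu\cos\alpha_i$ for all $w\le\hat w_i$). Let $w_{\rm in},w_{\rm fin}\ge 0$, let $w^{\max}\in\mathbb{R}^n$ have nonnegative entries with $w^{\max}_1=w_{\rm in}$, $w^{\max}_n=w_{\rm fin}$, and let $w^{\min}\in\mathbb{R}^n$ with $w^{\min}_1=w_{\rm in}$, $w^{\min}_n=w_{\rm fin}$, $w^{\min}_i=0$ for $2\le i\le n-1$. For $w\in\mathbb{R}^n$ put $f_i(w)=\frac1h(w_{i+1}-w_i)+\gamma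 w_i+g(\sin\alpha_i+c\cos\alpha_i)$. With $i$ ranging over $\{1,\dots,n-1\}$ define $X_1=\{w: f_i(w)\le\beta_i(w_i)\ \forall i,\ w\ge w^{\min}\}$, $X_2=\{w: f_i(w)\le\beta_i(w_i)\ \forall i,\ w\le w^{\max}\}$, $X_3=\{w: f_i(w)\ge-g\mu\cos\alpha_i\ \forall i,\ w\ge w^{\min}\}$, $X_4=\{w: f_i(w)\ge-g\mu\cos\alpha_i\ \forall i,\ w\le w^{\max}\}$, and $X=X_1\cap X_2\cap X_3\cap X_4$ (all subsets of $\mathbb{R}^n$). *)

(* Defs.v *)
From HB Require Import structures.
From mathcomp Require Export all_boot all_order all_algebra.
From mathcomp Require Export all_classical all_reals all_analysis.
Export Order.TTheory GRing.Theory Num.Theory.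

Set Implicit Arguments.
Unset Strict Implicit.
Unset Printing Implicit Defensive.

Local Open Scope classical_set_scope.
Local Open Scope ring_scope.

(* The vectors have m.+1 entries, numbered from 0; the constraints are indexed
   by i : 'I_m, and [cur i], [nxt i] are the positions i and i.+1. *)
Definition cur (m : nat) (i : 'I_m) : 'I_m.+1 := widen_ord (leqnSn m) i.
Definition nxt (m : nat) (i : 'I_m) : 'I_m.+1 := lift ord0 i.

Definition vle (R : realType) (n : nat) (u v : 'rV[R]_n) : Prop :=
  forall i, u 0 i <= v 0 i.

Definition coords (R : realType) (n : nat) (A : set 'rV[R]_n) (i : 'I_n) :
    set R :=
  [set w 0 i | w in A].

Definition is_max (R : realType) (A : set R) (x : R) : Prop :=
  A x /\ ubound A x.

Definition is_min (R : realType) (A : set R) (x : R) : Prop :=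
  A x /\ lbound A x.

Definition power_bound (R : realType) (M Pmax w : R) : \bar R :=
  if w <= 0 then +oo%E else (Pmax / (M * Num.sqrt (2 * w)))%:E.

Definition beta (R : realType) (m : nat) (M Pmax g mu : R) (alpha : 'I_m -> R)
    (i : 'I_m) (w : R) : \bar R :=
  mine (power_bound M Pmax w) (g * mu * cos (alpha i))%:E.

Definition force (R : realType) (m : nat) (h g gamma c : R) (alpha : 'I_m -> R)
    (i : 'I_m) (w : 'rV[R]_m.+1) : R :=
  h^-1 * (w 0 (nxt i) - w 0 (cur i)) + gamma * w 0 (cur i)
  + g * (sin (alpha i) + c * cos (alpha i)).

Definition traction_ok (R : realType) (m : nat) (h M Pmax g mu gamma c : R)
    (alpha : 'I_m -> R) (w : 'rV[R]_m.+1) : Prop :=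
  forall i : 'I_m, ((force h g gamma c alpha i w)%:E
                    <= beta M Pmax g mu alpha i (w 0%R (cur i)))%E.

Definition braking_ok (R : realType) (m : nat) (h g mu gamma c : R)
    (alpha : 'I_m -> R) (w : 'rV[R]_m.+1) : Prop :=
  forall i : 'I_m, - (g * mu * cos (alpha i)) <= force h g gamma c alpha i w.

Definition setX1 (R : realType) (m : nat) (h M Pmax g mu gamma c : R)
    (alpha : 'I_m -> R) (wmin : 'rV[R]_m.+1) : set 'rV[R]_m.+1 :=
  [set w | traction_ok h M Pmax g mu gamma c alpha w /\ vle wmin w].

Definition setX2 (R : realType) (m : nat) (h M Pmax g mu gamma c : R)
    (alpha : 'I_m -> R) (wmax : 'rV[R]_m.+1) : set 'rV[R]_m.+1 :=
  [set w | traction_ok h M Pmax g mu gamma c alpha w /\ vle w wmax].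

Definition setX3 (R : realType) (m : nat) (h g mu gamma c : R)
    (alpha : 'I_m -> R) (wmin : 'rV[R]_m.+1) : set 'rV[R]_m.+1 :=
  [set w | braking_ok h g mu gamma c alpha w /\ vle wmin w].

Definition setX4 (R : realType) (m : nat) (h g mu gamma c : R)
    (alpha : 'I_m -> R) (wmax : 'rV[R]_m.+1) : set 'rV[R]_m.+1 :=
  [set w | braking_ok h g mu gamma c alpha w /\ vle w wmax].

(* Main.v *)
Require Import Defs.
From mathcomp Require Import all_boot all_order all_algebra.
From mathcomp Require Import all_classical all_reals all_analysis.
From mathcomp Require Import ring lra.

Set Implicit Arguments.
Unset Strict Implicit.
Unset Printing Implicit Defensive.

Import Order.TTheory GRing.Theory Num.Theory.

(* Both constraints at step i say p_i (w_i) <= w_{i+1} <= q_i (w_i) with p_i and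
   q_i nondecreasing and Lipschitz; the assumption on h is what makes q_i
   nondecreasing. Solutions of such a system that lie below a given vector are
   stable under componentwise suprema, so there is a greatest one, z; the
   symmetry w |-> - w yields a least solution y above a given vector. If y <= z
   then y and z satisfy each other's bound, hence both lie in X. *)

Local Open Scope classical_set_scope.
Local Open Scope ring_scope.

(** Monotonicity and the Lipschitz bound are joined in one condition because the reflection of [F]
    through the origin then satisfies it with the same [a]. *)
Definition mono_lip (R : realType) (a : R) (F : R -> R) : Prop :=
  forall x x', x <= x' -> F x <= F x' <= F x + a * (x' - x).

Definition feasible (R : realType) (m : nat) (p q : 'I_m -> R -> R)
    (w : 'rV[R]_m.+1) : Prop :=
  forall i, p i (w 0 (cur i)) <= w 0 (nxt i) <= q i (w 0 (cur i)).

(* The affine recursion w_{i+1} = a w_i - e_i is solved by - a^k N + s_k, which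
   is arbitrarily negative for large N. *)
Lemma affine_below (R : realType) (m : nat) (a : R) (e : 'I_m -> R)
    (u : 'rV[R]_m.+1) : 0 < a ->
  exists w : 'rV[R]_m.+1,
    (forall i, w 0 (nxt i) = a * w 0 (cur i) - e i) /\ vle w u.
Proof.
move=> a0.
(* Extension of [e] by 0 to all naturals, so that the recursion for [s] can run over [nat]. *)
pose en k := if insub k is Some i then e i else 0.
pose s := fix s k : R := if k is k'.+1 then a * s k' - en k' else 0.
(* A sum of absolute values dominates each of its terms, so this single [N] works for every
   entry. *)
pose N := \sum_(k < m.+1) `|(s k - u 0 k) / a ^+ k|.
exists (\row_k (s k - a ^+ k * N)); split=> [i|k].
  rewrite !mxE /= /bump leq0n add1n /= exprS.
  have -> : en i = e i by rewrite /en valK.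
  ring.
rewrite !mxE lerBlDr -lerBlDl mulrC -ler_pdivrMr ?exprn_gt0//.
rewrite (le_trans (ler_norm _))// /N (bigD1 k)//= lerDl.
exact: sumr_ge0.
Qed.

(** The entrywise supremum of the feasible vectors below [u] is itself feasible. The affine map
    between [p] and [q] ensures that such vectors exist. *)
Lemma feasible_greatest (R : realType) (m : nat) (a : R) (e : 'I_m -> R)
    (p q : 'I_m -> R -> R) (u : 'rV[R]_m.+1) : 0 < a ->
  (forall i, mono_lip a (p i)) -> (forall i, mono_lip a (q i)) ->
  (forall i x, p i x <= a * x - e i <= q i x) ->
  exists z : 'rV[R]_m.+1, [/\ feasible p q z, vle z u &
    forall w, feasible p q w -> vle w u -> vle w z].
Proof.
move=> a_gt0 hp hq hpq.
pose A : set 'rV[R]_m.+1 := [set w | feasible p q w /\ vle w u].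
have [w0 [w0e w0u]] := affine_below e u a_gt0.
have Aw0 : A w0 by split=> // i; rewrite w0e hpq.
have supA i : has_sup (coords A i).
  split; first by exists (w0 0 i); exists w0.
  by exists (u 0 i) => _ [w [_ wu] <-].
pose z : 'rV[R]_m.+1 := \row_i sup (coords A i).
have Az w : A w -> vle w z.
  by move=> Aw i; rewrite mxE; apply: ub_le_sup; [case: (supA i)|exists w].
have zub i x : (forall w, A w -> w 0 i <= x) -> z 0 i <= x.
  move=> Ax; rewrite mxE; apply: ge_sup; first by case: (supA i).
  by move=> _ [w Aw <-]; exact: Ax.
exists z; split=> [i|i|w hw wu]; last by apply: Az.
  apply/andP; split.
    (* The Lipschitz bound gives [p i (z_i) <= z_{i+1} + a * (z_i - w_i)] for each [w] in [A].
       Solved for [w_i], this is an upper bound independent of [w], hence one for [z_i]. *)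
    have zi : z 0 (cur i) <= z 0 (cur i) - (p i (z 0 (cur i)) - z 0 (nxt i)) / a.
      apply: zub => w Aw.
      have [/(_ i)/andP[pw _] _] := Aw.
      have /andP[_ pz] := hp i _ _ (Az _ Aw (cur i)).
      rewrite lerBrDl -lerBrDr ler_pdivrMr// [_ * a]mulrC.
      have := Az _ Aw (nxt i); lra.
    by move: zi; rewrite lerDl oppr_ge0 pmulr_lle0 ?invr_gt0// subr_le0.
  (* Here monotonicity suffices: [w_{i+1} <= q i (w_i) <= q i (z_i)]. *)
  apply: zub => w Aw; have [/(_ i)/andP[_ qw] _] := Aw.
  by have /andP[qz _] := hq i _ _ (Az _ Aw (cur i)); exact: le_trans qz.
by apply: zub => w [_].
Qed.

Lemma mono_lip_opp (R : realType) (a : R) (F : R -> R) :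
  mono_lip a F -> mono_lip a (fun x => - F (- x)).
Proof.
move=> hF x x' xx'; have := hF (- x') (- x); rewrite lerN2 => /(_ xx').
by move=> /andP[? ?]; apply/andP; split; lra.
Qed.

Lemma feasible_least (R : realType) (m : nat) (a : R) (e : 'I_m -> R)
    (p q : 'I_m -> R -> R) (u : 'rV[R]_m.+1) : 0 < a ->
  (forall i, mono_lip a (p i)) -> (forall i, mono_lip a (q i)) ->
  (forall i x, p i x <= a * x - e i <= q i x) ->
  exists y : 'rV[R]_m.+1, [/\ feasible p q y, vle u y &
    forall w, feasible p q w -> vle u w -> vle y w].
Proof.
move=> a0 hp hq hpq.
(* Negation reverses inequalities, so the lower and upper bounds trade places. *)
pose p' i x := - q i (- x); pose q' i x := - p i (- x).
have feasN w : feasible p' q' w <-> feasible p q (- w).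
  by split=> hw i; have /andP[] := hw i; rewrite /p' /q' !mxE => ? ?;
    apply/andP; split; lra.
have vleN (v w : 'rV[R]_m.+1) : vle (- v) w -> vle (- w) v.
  by move=> vw i; have := vw i; rewrite !mxE lerNl.
have [||i x|z [/feasN hz zu hmax]] :=
    @feasible_greatest R m a (fun i => - e i) p' q' (- u) a0.
- by move=> i; exact: mono_lip_opp.
- by move=> i; exact: mono_lip_opp.
- by have /andP[? ?] := hpq i (- x); rewrite /p' /q'; apply/andP; split; lra.
exists (- z); split=> //.
  by move=> i; have := zu i; rewrite !mxE lerNr.
move=> w hw uw; apply/vleN/hmax; first by apply/feasN; rewrite opprK.
by move=> i; rewrite !mxE lerN2.
Qed.

(* In the variable [s = Num.max r (sqrt (2 x))], with [r = sqrt (2 what)], the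
   traction bound is [Pmax / (M * s)] for all [x]: for [x <= 0] MathComp's square
   root is 0. *)
Lemma betaE (R : realType) (m : nat) (M Pmax g mu : R) (alpha : 'I_m -> R)
    (i : 'I_m) (r x : R) :
  0 < M -> 0 < Pmax -> 0 < r -> Pmax / (M * r) = g * mu * cos (alpha i) ->
  beta M Pmax g mu alpha i x =
    (Pmax / (M * Num.max r (Num.sqrt (2 * x))))%:E.
Proof.
move=> M0 P0 r0 hr; rewrite /beta /power_bound -hr.
case: ifPn => [x0|]; last rewrite -ltNge => x0.
  by rewrite minye ler0_sqrtr ?pmulr_rle0// max_l// ltW.
have s0 : 0 < Num.sqrt (2 * x) by rewrite sqrtr_gt0 mulr_gt0.
have le_bound (s t : R) : 0 < s -> s <= t -> Pmax / (M * t) <= Pmax / (M * s).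
  move=> s0' st; have t0 := lt_le_trans s0' st.
  by rewrite ler_pM2l// lef_pV2 ?posrE ?mulr_gt0// ler_pM2l.
rewrite -EFin_min; congr EFin.
have [rs|/ltW sr] := leP r (Num.sqrt (2 * x)).
  by rewrite min_l// le_bound.
by rewrite min_r// le_bound.
Qed.

(** Where [s = sqrt (2 x)], the derivative of [P / (M * s)] in [x] is [- P / (M * s ^+ 3)], of size
    at most [P / (M * r ^+ 3)] as [s >= r]. Difference quotients replace derivatives because of the
    kink at [s = r]. *)
Lemma mono_lip_traction (R : realType) (a h M P r d : R) :
  0 < h -> 0 < M -> 0 < P -> 0 < r -> h * (P / (M * r ^+ 3)) <= a ->
  mono_lip a (fun x => a * x + h * (P / (M * Num.max r (Num.sqrt (2 * x)))) - d).
Proof.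
move=> h0 M0 P0 r0 har x x' xx'.
set s := Num.max r (Num.sqrt (2 * x)); set t := Num.max r (Num.sqrt (2 * x')).
have rs : r <= s by rewrite le_max lexx.
have sqrtxx' : Num.sqrt (2 * x) <= Num.sqrt (2 * x').
  by rewrite ler_wsqrtr// ler_pM2l.
have st : s <= t by rewrite ge_max !le_max lexx sqrtxx' orbT.
have s0 : 0 < s := lt_le_trans r0 rs.
have t0 : 0 < t := lt_le_trans s0 st.
(* The square of [s] is the maximum of [r ^+ 2] and [2 * x], which grows in [x] with slope at most
   2. *)
have sqst : t ^+ 2 - s ^+ 2 <= 2 * (x' - x).
  have [x'r|rx'] := leP (Num.sqrt (2 * x')) r.
    have -> : t = r by apply: max_l.
    have -> : s = r by apply: max_l; exact: le_trans x'r.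
    by rewrite subrr; lra.
  have -> : t = Num.sqrt (2 * x') by apply: max_r; exact: ltW.
  have x'0 : 0 < 2 * x' by rewrite -sqrtr_gt0; exact: lt_trans rx'.
  rewrite sqr_sqrtr ?(ltW x'0)//.
  have [x0|x0] := leP 0 (2 * x); last first.
    have := sqr_ge0 s; lra.
  have : Num.sqrt (2 * x) ^+ 2 <= s ^+ 2.
    have sqrt_le_s : Num.sqrt (2 * x) <= s by rewrite le_max lexx orbT.
    by rewrite ler_pXn2r ?nnegrE ?sqrtr_ge0 ?(ltW s0).
  rewrite sqr_sqrtr//; lra.
have a0 : 0 < a.
  by apply: lt_le_trans har; rewrite mulr_gt0// divr_gt0// mulr_gt0// exprn_gt0.
have diffE : P / (M * s) - P / (M * t) = P / (M * (s * t)) * (t - s).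
  by field; rewrite !gt_eqF.
have diff_ge0 : 0 <= P / (M * s) - P / (M * t).
  by rewrite diffE mulr_ge0 ?subr_ge0// ltW// divr_gt0// !mulr_gt0.
(* Uses [s * t >= r ^+ 2] and [r <= (s + t) / 2]. The factor [(s + t) / 2] times [t - s] then gives
   half the difference of squares. *)
have slope : h * (P / (M * (s * t))) <= a * ((s + t) / 2).
  have : h * (P / (M * (s * t))) <= h * (P / (M * r ^+ 3)) * r.
    have -> : h * (P / (M * r ^+ 3)) * r = h * (P / (M * (r * r))).
      by field; rewrite !gt_eqF.
    rewrite ler_pM2l// ler_pM2l// lef_pV2 ?posrE ?mulr_gt0// ler_pM2l//.
    by apply: ler_pM; rewrite ?(ltW r0)//; exact: le_trans st.
  move=> /le_trans; apply.
  apply: ler_pM => //; first by rewrite ltW// mulr_gt0// divr_gt0// mulr_gt0// exprn_gt0.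
  - exact: ltW.
  - lra.
have : h * (P / (M * s) - P / (M * t)) <= a * (x' - x).
  rewrite diffE mulrA.
  apply: (@le_trans _ _ (a * ((s + t) / 2) * (t - s))).
    by rewrite ler_wpM2r// subr_ge0.
  have -> : a * ((s + t) / 2) * (t - s) = a * ((t ^+ 2 - s ^+ 2) / 2) by field.
  by rewrite ler_pM2l//; lra.
move=> bound; apply/andP; split; first by move: bound; lra.
have := mulr_ge0 (ltW h0) diff_ge0; lra.
Qed.

Theorem proposition3p3 (R : realType) (m : nat) (hn : (3 <= m.+1)%N)
  (h M Pmax g mu gamma c : R)
  (h_gt0 : 0 < h) (M_gt0 : 0 < M) (Pmax_gt0 : 0 < Pmax) (g_gt0 : 0 < g)
  (mu_gt0 : 0 < mu) (gamma_gt0 : 0 < gamma) (c_ge0 : 0 <= c)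
  (alpha : 'I_m -> R)
  (halpha : forall i, - (pi / 2) < alpha i < pi / 2)
  (what : 'I_m -> R)
  (what_gt0 : forall i, 0 < what i)
  (hwhat : forall i,
    Pmax / (M * Num.sqrt (2 * what i)) = g * mu * cos (alpha i))
  (hstep : forall i,
    0 <= 1 - h * gamma - h * (Pmax / (M * (2 * what i) `^ (3 / 2))))
  (win wfin : R) (win_ge0 : 0 <= win) (wfin_ge0 : 0 <= wfin)
  (wmax : 'rV[R]_m.+1)
  (wmax_ge0 : forall i, 0 <= wmax 0 i)
  (wmax_first : wmax 0 ord0 = win) (wmax_last : wmax 0 ord_max = wfin)
  (wmin : 'rV[R]_m.+1)
  (wmin_first : wmin 0 ord0 = win) (wmin_last : wmin 0 ord_max = wfin)
  (wmin_mid : forall i, i != ord0 -> i != ord_max -> wmin 0 i = 0) :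
  let X1 := setX1 h M Pmax g mu gamma c alpha wmin in
  let X2 := setX2 h M Pmax g mu gamma c alpha wmax in
  let X3 := setX3 h g mu gamma c alpha wmin in
  let X4 := setX4 h g mu gamma c alpha wmax in
  let X := X1 `&` X2 `&` X3 `&` X4 in
  exists z y : 'rV[R]_m.+1,
    [/\ forall i, is_max (coords (X2 `&` X4) i) (z 0 i),
        forall i, is_min (coords (X1 `&` X3) i) (y 0 i),
        X !=set0 <-> vle y z
      & X !=set0 ->
        forall i, is_max (coords X i) (z 0 i) /\ is_min (coords X i) (y 0 i)].
Proof.
move=> X1 X2 X3 X4 X.
pose a := 1 - h * gamma.
pose r i := Num.sqrt (2 * what i).
pose d i := h * (g * (sin (alpha i) + c * cos (alpha i))).
pose p i x := a * x - (h * (g * mu * cos (alpha i)) + d i).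
pose q i x := a * x + h * (Pmax / (M * Num.max (r i) (Num.sqrt (2 * x)))) - d i.
have r_gt0 i : 0 < r i by rewrite sqrtr_gt0 mulr_gt0.
have power_gt0 s : 0 < s -> 0 < Pmax / (M * s).
  by move=> s0; rewrite divr_gt0// mulr_gt0.
have har i : h * (Pmax / (M * r i ^+ 3)) <= a.
  have w20 : 0 <= 2 * what i by rewrite mulr_ge0// ltW.
  have -> : r i ^+ 3 = (2 * what i) `^ (3 / 2).
    by rewrite /r -powR12_sqrt// -powR_mulrn ?powR_ge0// -powRrM [2^-1 * _]mulrC.
  by rewrite -subr_ge0 hstep.
(* Strict because the power term in [har] is positive; the bound on [n] supplies an index at which
   to use it. *)
have a_gt0 : 0 < a.
  have i0 : 'I_m by exists 0%N; rewrite -ltnS; apply: leq_trans hn.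
  apply: lt_le_trans (har i0); rewrite mulr_gt0// power_gt0//.
  exact: exprn_gt0.
have hp i : mono_lip a (p i).
  move=> x x' xx'; rewrite /p; have := ler_wpM2l (ltW a_gt0) xx'.
  by move=> ?; apply/andP; split; lra.
have hq i : mono_lip a (q i) by apply: mono_lip_traction.
(* The middle term is the next entry at which [force] vanishes; zero lies between the braking and
   traction bounds. *)
have hpq i x : p i x <= a * x - d i <= q i x.
  have : 0 < h * (g * mu * cos (alpha i)).
    by rewrite -hwhat mulr_gt0// power_gt0 ?r_gt0.
  have : 0 < h * (Pmax / (M * Num.max (r i) (Num.sqrt (2 * x)))).
    by rewrite mulr_gt0// power_gt0// lt_max r_gt0.
  by rewrite /p /q => ? ?; apply/andP; split; lra.
have hforce i w : h * force h g gamma c alpha i w =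
    w 0 (nxt i) - a * w 0 (cur i) + d i.
  by rewrite /force /a /d; field; rewrite gt_eqF.
have tractionE i w : ((force h g gamma c alpha i w)%:E
    <= beta M Pmax g mu alpha i (w 0%R (cur i)))%E =
    (w 0 (nxt i) <= q i (w 0 (cur i))).
  rewrite (betaE _ M_gt0 Pmax_gt0 (r_gt0 i) (hwhat i)) lee_fin.
  rewrite -(ler_pM2l h_gt0) hforce /q.
  by apply/idP/idP; lra.
have brakingE i w : (- (g * mu * cos (alpha i)) <= force h g gamma c alpha i w) =
    (p i (w 0 (cur i)) <= w 0 (nxt i)).
  rewrite -(ler_pM2l h_gt0) hforce /p.
  by apply/idP/idP; lra.
have feasE w : feasible p q w <->
    traction_ok h M Pmax g mu gamma c alpha w /\
    braking_ok h g mu gamma c alpha w.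
  split=> [hw|[tw bw] i]; last by rewrite -brakingE -tractionE bw tw.
  by split=> i; have /andP[] := hw i; rewrite -brakingE -tractionE.
have upperE w : (X2 `&` X4) w <-> feasible p q w /\ vle w wmax.
  split=> [[[? ?] [? _]]|[/feasE[? ?] ?]]; last by [].
  by split=> //; apply/feasE.
have lowerE w : (X1 `&` X3) w <-> feasible p q w /\ vle wmin w.
  split=> [[[? ?] [? _]]|[/feasE[? ?] ?]]; last by [].
  by split=> //; apply/feasE.
have XE w : X w <-> (X1 `&` X3) w /\ (X2 `&` X4) w.
  by split=> [[[[]]]|[[? ?] [? ?]]].
have [z [fz zmax hz]] := feasible_greatest wmax a_gt0 hp hq hpq.
have [y [fy ymin hy]] := feasible_least wmin a_gt0 hp hq hpq.
have z_ub i : ubound (coords (X2 `&` X4) i) (z 0 i).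
  by move=> _ [w /upperE[fw wmaxw] <-]; exact: hz.
have y_lb i : lbound (coords (X1 `&` X3) i) (y 0 i).
  by move=> _ [w /lowerE[fw wminw] <-]; exact: hy.
have X_le_yz : X !=set0 -> vle y z.
  move=> [w /XE[/lowerE[fw wminw] /upperE[_ wmaxw]]] i.
  by apply: (@le_trans _ _ (w 0 i)); [exact: hy|exact: hz].
(* The missing bounds come by transitivity: [y <= z <= wmax] and [wmin <= y <= z]. *)
have Xyz : vle y z -> X y /\ X z.
  move=> yz; split; apply/XE; split; apply/lowerE || apply/upperE.
  - by [].
  - by split=> // i; apply: le_trans (yz i) (zmax i).
  - by split=> // i; apply: le_trans (ymin i) (yz i).
  - by [].
exists z, y; split=> [i|i||/X_le_yz/Xyz[Xy Xz] i].
- by split=> //; exists z => //; apply/upperE.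
- by split=> //; exists y => //; apply/lowerE.
- by split=> // /Xyz[Xy _]; exists y.
split; split.
- by exists z.
- by move=> _ [w /XE[_ Xw] <-]; apply: z_ub; exists w.
- by exists y.
- by move=> _ [w /XE[Xw _] <-]; apply: y_lb; exists w.
Qed.
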